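(* For each pair partition $\mathfrak{m}\in\mathcal{P}_k$, with $t=1-\frac NM$, the Weingarten function has the large $N$ expansion (with $M/N=1/(1-t)$ held fixed) \[ \mathrm{Wg}^{\mathbf{A}}(\mathfrak{m})=\frac1{(1-t)^k}\sum_{r=0}^\infty \vec h^{(t)}_r(\mathfrak{m})\Big(-\frac1N\Big)^r. \]
   Context: $\mathbf{A}(M,N)$ ($M<N$) is the space of $N\times N$ real symmetric idempotent matrices of rank $M$ with its $\mathrm{O}(N)$-invariant Haar probability measure $\mathrm{d}\mu$; $A_{ij}$ is the $(i,j)$ entry. $\mathcal{P}_k$ is the set of pair partitions of $\{1,\ldots,2k\}$; $\mathfrak{e}_k=\{\{1,2\},\{3,4\},\ldots,\{2k-1,2k\}\}$. $S_{2k}$ acts on $\mathcal{P}_k$ by $\{a,b\}\in\mathfrak{m}\iff\{\sigma(a),\sigma(b)\}\in\sigma\cdot\mathfrak{m}$. $\mathrm{Wg}^{\mathbf{A}}(\mathfrak{m})=\int_{\mathbf{A}(M,N)}A_{i(1)i(2)}\cdots A_{i(2k-1)i(2k)}\,\mathrm{d}\mu$, where $i:\{1,\ldots,2k\}\to\{1,\ldots,N\}$ satisfies $i(a)=i(b)\iff\{a,b\}\in\mathfrak{m}$ for $a\ne b$. A monotone factorisation of $\mathfrak{m}\in\mathcal{P}_k$ is a sequence $\boldsymbol\tau=(\tau_1,\ldots,\tau_r)$ of transpositions $\tau_s=(a_s~b_s)\in S_{2k}$, $a_s<b_s$, with $b_1\le b_2\le\cdots\le b_r$ all odd and $\tau_1\circ\cdots\circ\tau_r\cdot\mathfrak{m}=\mathfrak{e}_k$;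 its length is $r$ and its hive number $\mathrm{hive}(\boldsymbol\tau)$ is the number of distinct values among $b_1,\ldots,b_r$. $\vec h^{(t)}_r(\mathfrak{m})\in\mathbb{Z}[t]$ is the sum of $t^{\mathrm{hive}(\boldsymbol\tau)}$ over monotone factorisations $\boldsymbol\tau$ of $\mathfrak{m}$ of length $r$. *)

(* Defs.v *)
From HB Require Import structures.
From mathcomp Require Import all_boot all_order all_algebra all_fingroup.
From mathcomp Require Import all_classical all_reals all_analysis.
From mathcomp Require Import zify.
Set Implicit Arguments. Unset Strict Implicit. Unset Printing Implicit Defensive.
Import Order.TTheory GRing.Theory Num.Theory.
Import numFieldNormedType.Exports.
Local Open Scope ring_scope.

(* Points 1..2k are represented 0-indexed by 'I_(2*k): the point p (1-indexed)
   is the ordinal of value p-1. *)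

Definition pair_partition (k : nat) (m : {set {set 'I_(2*k)}}) : bool :=
  finset.partition m [set: 'I_(2*k)] && [forall B in m, #|B| == 2%N].

Lemma ltn_fst (k : nat) (l : 'I_k) : (2 * l < 2 * k)%N.
Proof. by rewrite ltn_pmul2l. Qed.

Lemma ltn_snd (k : nat) (l : 'I_k) : ((2 * l).+1 < 2 * k)%N.
Proof. have := ltn_ord l; lia. Qed.

(* the points 2l+1 and 2l+2 (1-indexed), for l = 0..k-1 *)
Definition ofst (k : nat) (l : 'I_k) : 'I_(2*k) := Ordinal (ltn_fst l).
Definition osnd (k : nat) (l : 'I_k) : 'I_(2*k) := Ordinal (ltn_snd l).

Definition e_part (k : nat) : {set {set 'I_(2*k)}} :=
  [set [set ofst l; osnd l] | l : 'I_k].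

Definition pp_act (k : nat) (s : {perm 'I_(2*k)}) (m : {set {set 'I_(2*k)}})
  : {set {set 'I_(2*k)}} := imset (fun B : {set 'I_(2*k)} => imset s (mem B)) (mem m).

Definition transp (k : nat) (ab : 'I_(2*k) * 'I_(2*k)) : {perm 'I_(2*k)} :=
  tperm ab.1 ab.2.

Definition act_seq (k : nat) (s : seq ('I_(2*k) * 'I_(2*k)))
  (m : {set {set 'I_(2*k)}}) : {set {set 'I_(2*k)}} :=
  foldr (fun ab m' => pp_act (transp ab) m') m s.

(* monotone factorisation of m: a_s < b_s, b_1 <= ... <= b_r, all b_s odd
   (1-indexed, i.e. the 0-indexed value of b_s is even), and
   tau_1 o ... o tau_r . m = e_k *)
Definition monotone_fact (k : nat) (m : {set {set 'I_(2*k)}})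
  (s : seq ('I_(2*k) * 'I_(2*k))) : bool :=
  [&& all (fun ab : 'I_(2*k) * 'I_(2*k) => (nat_of_ord ab.1 < nat_of_ord ab.2)%N) s,
      sorted leq (map (fun ab : 'I_(2*k) * 'I_(2*k) => nat_of_ord ab.2) s),
      all (fun ab : 'I_(2*k) * 'I_(2*k) => odd (nat_of_ord ab.2).+1) s &
      act_seq s m == e_part k].

Definition hive (k : nat) (s : seq ('I_(2*k) * 'I_(2*k))) : nat :=
  size (undup (map snd s)).

Definition hpoly (k r : nat) (m : {set {set 'I_(2*k)}}) : {poly int} :=
  \sum_(s : r.-tuple ('I_(2*k) * 'I_(2*k)) | monotone_fact m s) 'X^(hive s).

Definition heval (R : realType) (k r : nat) (m : {set {set 'I_(2*k)}}) (t : R)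
  : R := (map_poly (fun z : int => z%:~R) (hpoly r m)).[t].

(* sigma-algebra on N x N real matrices generated by the entry maps
   (= the Borel sigma-algebra of R^(N*N)) *)
Definition mxR (R : realType) (N : nat) : Type := 'M[R]_N.
HB.instance Definition _ (R : realType) (N : nat) := Choice.on (mxR R N).
HB.instance Definition _ (R : realType) (N : nat) := isPointed.Build (mxR R N) 0%R.

Definition mx_entry_sets (R : realType) (N : nat) : set (set (mxR R N)) :=
  [set B | exists i j (C : set R), measurable C /\
     B = (fun A : mxR R N => (A : 'M[R]_N) i j) @^-1` C]%classic.

Notation MxSpace R N := (g_sigma_algebraType (@mx_entry_sets R N)).

Definition Aspace (R : realType) (M N : nat) : set 'M[R]_N :=
  [set A | A^T = A /\ A *m A = A /\ \rank A = M]%classic.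

Definition orthogonal_mx (R : realType) (N : nat) (O : 'M[R]_N) : Prop :=
  O *m O^T = 1%:M.

Definition haar_A (R : realType) (M N : nat)
  (mu : probability (MxSpace R N) R) : Prop :=
  mu.-negligible (~` (@Aspace R M N : set (MxSpace R N)))%classic /\
  (forall O : 'M[R]_N, orthogonal_mx O ->
     forall B : set (MxSpace R N), measurable B ->
       mu ((fun A : MxSpace R N => (O *m A *m O^T : MxSpace R N)) @^-1` B)%classic = mu B).

Definition adapted (k N : nat) (m : {set {set 'I_(2*k)}}) (i : 'I_(2*k) -> 'I_N)
  : bool := [forall a, forall b, (a != b) ==> ((i a == i b) == ([set a; b] \in m))].

Definition wg_integrand (R : realType) (k N : nat) (i : 'I_(2*k) -> 'I_N)
  (A : 'M[R]_N) : R :=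
  \prod_(l < k) A (i (ofst l)) (i (osnd l)).

(* Main.v *)
Require Import Defs.
From HB Require Import structures.
From mathcomp Require Import all_boot all_order all_algebra all_fingroup.
From mathcomp Require Import all_classical all_reals all_analysis measurable_realfun.
From mathcomp Require Import ring lra zify.
Import Order.TTheory GRing.Theory Num.Theory.
Import numFieldNormedType.Exports.
Local Open Scope classical_set_scope.
Local Open Scope ring_scope.
Set Implicit Arguments.
Unset Strict Implicit.
Unset Printing Implicit Defensive.

(* Replace the pair partition m by a colouring c of the 2k points whose fibres
   are the pairs of m, on which transpositions act by precomposition, and write
   Phi_j(c) for the expectation of the product of the first j entries
   A_{c(1)c(2)} ... A_{c(2j-1)c(2j)}.

   Let p be the colour of the point 2j+1, and sum Phi_{j+1} over all
   recolourings of p into a colour q.  On the one hand, tr A = M and A^2 = A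
   contract the sum over q into expectations of degree j.  On the other hand, if
   q is a colour of c other than p, then four indices coincide, and invariance
   under a rotation by 45 degrees in the (p, q)-plane shows that the recoloured
   moment is Phi_{j+1}(c) plus the two terms Phi_{j+1}(c o (a 2j+1)) with a of
   colour q.  This gives
     N Phi_{j+1}(c) + sum_{a <= 2j} Phi_{j+1}(c o (a 2j+1))
       = M Phi'(c) + sum_{a <= 2j} Phi'(c o (a 2j+1)),
   where Phi' is Phi_j if the points 2j+1 and 2j+2 have the same colour, and 0
   otherwise.  Removing the last transposition of a monotone factorisation, with
   a factor t when it is the only one with b = 2j+1, gives the same recursion
   for the generating series at -1/N.  For N > 2k the operator
   -1/N sum_a (a 2j+1) is a contraction, so the partial sums converge to the
   rescaled moments, by induction on j. *)

(** Write [A] as [col_base A *m row_base A]. Idempotence and the full rank of the two factors force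
    their product in the other order to be the identity of size [\rank A], and the trace is
    cyclic. *)
Lemma mxtrace_idempotent (F : fieldType) (n : nat) (A : 'M[F]_n) :
  A *m A = A -> \tr A = (\rank A)%:R.
Proof.
move=> AA.
have rc : row_base A *m col_base A = 1%:M.
  have fr := row_base_free A; have fc := col_base_full A.
  have h : col_base A *m ((row_base A *m col_base A) *m row_base A) =
           col_base A *m (1%:M *m row_base A).
    by rewrite mul1mx mulmxA mulmxA -mulmxA mulmx_base AA.
  have /(row_free_inj fr) := row_full_inj fc h.
  by [].
by rewrite -{1}(mulmx_base A) mxtrace_mulC rc mxtrace1.
Qed.

(** * Expectations of bounded functions of a random projection *)

Section BoundedObservables.

Variables (R : realType) (M N : nat).

(** Boundedness is required only on [Aspace], which carries all the mass; the entries themselves are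
    unbounded on the space of all matrices. *)
Definition bounded_obs (f : MxSpace R N -> R) : Prop :=
  measurable_fun setT f /\ exists C, forall A, @Aspace R M N A -> `|f A| <= C.

(** Since [A] is symmetric and idempotent, the squares in row [u] sum to [A u u]. Hence
    [A u u ^+ 2 <= A u u], so diagonal entries are at most 1, and they bound the squares of all
    entries in their row. *)
Lemma Aspace_entry (A : 'M[R]_N) i j : @Aspace R M N A -> `|A i j| <= 1.
Proof.
move=> [At [AA _]].
have sq u : \sum_v A u v ^+ 2 = A u u.
  by rewrite -[RHS](congr1 (fun B : 'M[R]_N => B u u) AA) !mxE;
     apply: eq_bigr => v _; rewrite expr2 -{2}At mxE.
have le u v : A u v ^+ 2 <= A u u.
  by rewrite -sq (bigD1 v) //= lerDl sumr_ge0 // => w _; rewrite sqr_ge0.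
have d1 : A i i <= 1.
  have := le i i; have := sqr_ge0 (A i i); nra.
rewrite -(@expr_le1 _ 2) // real_normK ?num_real //.
exact: le_trans (le i j) d1.
Qed.

Lemma measurable_entry i j : measurable_fun setT (fun A : MxSpace R N => (A : 'M[R]_N) i j).
Proof.
move=> _ C mC; rewrite setTI; apply: sub_sigma_algebra.
by exists i, j, C.
Qed.

Lemma bounded_obs_entry i j : bounded_obs (fun A => (A : 'M[R]_N) i j).
Proof.
by split; [exact: measurable_entry | exists 1 => A hA; exact: Aspace_entry].
Qed.

Lemma bounded_obs_cst (a : R) : bounded_obs (fun=> a).
Proof. by split; [exact: measurable_cst | exists `|a|]. Qed.

Lemma bounded_obsD f g : bounded_obs f -> bounded_obs g -> bounded_obs (fun A => f A + g A).
Proof.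
move=> [mf [C hC]] [mg [D hD]]; split; first exact: measurable_funD.
exists (C + D) => A hA; apply: le_trans (ler_normD _ _) _.
by apply: lerD; [exact: hC | exact: hD].
Qed.

Lemma bounded_obsM f g : bounded_obs f -> bounded_obs g -> bounded_obs (fun A => f A * g A).
Proof.
move=> [mf [C hC]] [mg [D hD]]; split; first exact: measurable_funM.
by exists (C * D) => A hA; rewrite normrM; apply: ler_pM; [| |exact: hC|exact: hD].
Qed.

Lemma bounded_obs_sum (I : Type) (r : seq I) (P : pred I) (F : I -> MxSpace R N -> R) :
  (forall i, P i -> bounded_obs (F i)) -> bounded_obs (fun A => \sum_(i <- r | P i) F i A).
Proof.
move=> hF; elim: r => [|i r IH].
  rewrite (_ : (fun _ => _) = fun=> 0); first exact: bounded_obs_cst.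
  by apply/funext => A; rewrite big_nil.
case Pi: (P i).
  rewrite (_ : (fun _ => _) = fun A => F i A + \sum_(j <- r | P j) F j A).
    by apply: bounded_obsD => //; exact: hF.
  by apply/funext => A; rewrite big_cons Pi.
rewrite (_ : (fun _ => _) = fun A => \sum_(j <- r | P j) F j A) //.
by apply/funext => A; rewrite big_cons Pi.
Qed.

Lemma bounded_obs_prod (I : Type) (r : seq I) (P : pred I) (F : I -> MxSpace R N -> R) :
  (forall i, P i -> bounded_obs (F i)) -> bounded_obs (fun A => \prod_(i <- r | P i) F i A).
Proof.
move=> hF; elim: r => [|i r IH].
  rewrite (_ : (fun _ => _) = fun=> 1); first exact: bounded_obs_cst.
  by apply/funext => A; rewrite big_nil.
case Pi: (P i).
  rewrite (_ : (fun _ => _) = fun A => F i A * \prod_(j <- r | P j) F j A).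
    by apply: bounded_obsM => //; exact: hF.
  by apply/funext => A; rewrite big_cons Pi.
rewrite (_ : (fun _ => _) = fun A => \prod_(j <- r | P j) F j A) //.
by apply/funext => A; rewrite big_cons Pi.
Qed.

Lemma Aspace_conj (O A : 'M[R]_N) :
  orthogonal_mx O -> @Aspace R M N A -> @Aspace R M N (O *m A *m O^T).
Proof.
move=> OO [At [AA rA]]; have OtO : O^T *m O = 1%:M by exact: mulmx1C.
have uO : O \in unitmx by case/mulmx1_unit: OO.
split; first by rewrite !trmx_mul trmxK At mulmxA.
split; last first.
  rewrite mxrankMfree ?row_free_unit ?unitmx_tr // -mxrank_tr trmx_mul.
  by rewrite mxrankMfree ?row_free_unit ?unitmx_tr // mxrank_tr.
rewrite -!mulmxA; congr (_ *m _).
by rewrite (mulmxA O^T) OtO mul1mx mulmxA AA.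
Qed.

Definition conj_mx (O : 'M[R]_N) (A : MxSpace R N) : MxSpace R N := O *m A *m O^T.

(** The entry maps generate the sigma-algebra, so it suffices that each entry of the conjugate is a
    linear combination of entries of [A]. *)
Lemma measurable_conj_mx (O : 'M[R]_N) : measurable_fun setT (conj_mx O).
Proof.
apply: (@measurability _ _ (MxSpace R N) (MxSpace R N) setT (conj_mx O)
  (@mx_entry_sets R N) erefl).
move=> _ [_ [i [j [C [mC ->]]]] <-].
have [mf _] : bounded_obs (fun A : MxSpace R N =>
    \sum_v (\sum_u O i u * (A : 'M[R]_N) u v) * O j v).
  apply: bounded_obs_sum => v _.
  apply: bounded_obsM; last exact: bounded_obs_cst.
  apply: bounded_obs_sum => u _; apply: bounded_obsM; first exact: bounded_obs_cst.
  exact: bounded_obs_entry.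
have := mf measurableT C mC.
rewrite !setTI; congr measurable; apply/funext => A /=; congr C.
by rewrite mxE; apply: eq_bigr => v _; rewrite !mxE.
Qed.

Lemma bounded_obs_conj (O : 'M[R]_N) f : orthogonal_mx O -> bounded_obs f ->
  bounded_obs (f \o conj_mx O).
Proof.
move=> OO [mf [C hC]]; split; first by apply: measurableT_comp => //; exact: measurable_conj_mx.
by exists C => A hA; apply: hC; exact: Aspace_conj.
Qed.

Variables (mu : probability (MxSpace R N) R).
Hypothesis haar : haar_A M mu.

Definition expect (f : MxSpace R N -> R) : R := Rintegral mu setT f.

Lemma ae_Aspace : {ae mu, forall A, @Aspace R M N A}.
Proof. by case: haar. Qed.

Lemma bounded_obs_integrable f : bounded_obs f -> mu.-integrable setT (EFin \o f).
Proof.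
move=> [mf [C hC]]; apply/integrableP; split; first exact/measurable_EFinP.
(* The comparison of integrals asks for a nonnegative dominating function, hence the absolute value
   of [C]. *)
apply: (@le_lt_trans _ _ (\int[mu]_(x in setT) (cst `|C|%:E) x)%E).
  apply: ae_ge0_le_integral => //.
  - by apply: measurableT_comp => //; exact/measurable_EFinP.
  - by move=> x _; rewrite /= lee_fin.
  - apply: (@filterS _ _ (ae_filter_ringOfSetsType mu) _ _ _ ae_Aspace) => A hA _ /=.
    rewrite lee_fin; exact: le_trans (hC A hA) (ler_norm _).
rewrite integral_cst // [X in (_ * X)%E](_ : _ = 1%E) ?mule1 ?ltry //.
exact: probability_setT.
Qed.

Lemma expectD f g : bounded_obs f -> bounded_obs g ->
  expect (fun A => f A + g A) = expect f + expect g.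
Proof. by move=> hf hg; apply: RintegralD => //; exact: bounded_obs_integrable. Qed.

Lemma expectZ (a : R) f : bounded_obs f -> expect (fun A => a * f A) = a * expect f.
Proof. by move=> hf; apply: RintegralZl => //; exact: bounded_obs_integrable. Qed.

Lemma expect_cst (a : R) : expect (fun=> a) = a.
Proof.
rewrite /expect Rintegral_cst // [X in fine X](_ : _ = 1%E) ?mulr1 //.
exact: probability_setT.
Qed.

Lemma expect_sum (I : Type) (r : seq I) (F : I -> MxSpace R N -> R) :
  (forall i, bounded_obs (F i)) ->
  expect (fun A => \sum_(i <- r) F i A) = \sum_(i <- r) expect (F i).
Proof.
move=> hF; elim: r => [|i r IH].
  by rewrite big_nil -[RHS]expect_cst; congr expect; apply/funext => A; rewrite big_nil.
rewrite big_cons -IH -expectD //; last exact: bounded_obs_sum.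
by congr expect; apply/funext => A; rewrite big_cons.
Qed.

(** Through this lemma the relations [A^T = A], [A *m A = A] and [\rank A = M] enter the computation
    of moments. *)
Lemma eq_expect f g : bounded_obs f -> bounded_obs g ->
  (forall A, @Aspace R M N A -> f A = g A) -> expect f = expect g.
Proof.
move=> [mf _] [mg _] fg; congr fine; apply: ae_eq_integral => //.
- exact/measurable_EFinP.
- exact/measurable_EFinP.
- by apply: (@filterS _ _ (ae_filter_ringOfSetsType mu) _ _ _ ae_Aspace) => A hA _ /=; rewrite fg.
Qed.

(** Change of variables: the pushforward of [mu] under conjugation agrees with [mu] on measurable
    sets. *)
Lemma expect_conj (O : 'M[R]_N) f : orthogonal_mx O -> bounded_obs f ->
  expect (f \o conj_mx O) = expect f.
Proof.
move=> OO hf; rewrite /expect /Rintegral; congr fine.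
have mO := measurable_conj_mx O.
have -> : (\int[mu]_(x in setT) ((f \o conj_mx O) x)%:E =
  \int[pushforward mu (conj_mx O)]_(x in setT) (f x)%:E)%E.
  rewrite (@integral_pushforward _ _ _ _ _ _ mO mu setT (EFin \o f)) //.
  - by apply/measurable_EFinP; case: hf.
  - by rewrite preimage_setT; apply: (bounded_obs_integrable (bounded_obs_conj OO hf)).
apply: (@eq_measure_integral _ _ _ setT mu) => // B mB _.
by have [_ /(_ O OO B mB)] := haar.
Qed.

End BoundedObservables.

(** * The 2k points as first and second members of k consecutive blocks *)

Section Positions.

Variable k : nat.

Lemma position_cases (s : 'I_(2 * k)) : exists l : 'I_k, s = ofst l \/ s = osnd l.
Proof.
have lt : (s./2 < k)%N by have := ltn_ord s; lia.
exists (Ordinal lt); case: (boolP (odd s)) => os; [right|left]; apply: val_inj => /=; lia.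
Qed.

Lemma ofst_inj : injective (@ofst k).
Proof. by move=> l l' /(congr1 val) /= h; apply: val_inj => /=; lia. Qed.

Lemma osnd_inj : injective (@osnd k).
Proof. by move=> l l' /(congr1 val) /= h; apply: val_inj => /=; lia. Qed.

Lemma ofst_neq_osnd (l l' : 'I_k) : (ofst l == osnd l') = false.
Proof. by apply/negP => /eqP /(congr1 val) /=; lia. Qed.

Lemma osnd_neq_ofst (l l' : 'I_k) : (osnd l == ofst l') = false.
Proof. by rewrite eq_sym ofst_neq_osnd. Qed.

End Positions.

(** * Orthogonal matrices acting in a coordinate plane *)

Section BlockOrthogonal.

Variables (R : realType) (N : nat) (p q : 'I_N).
Hypothesis pq : p != q.

Local Notation e := (delta_mx (0 : 'I_1)).

Definition block_mx2 (a b c d : R) : 'M[R]_N :=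
  \matrix_(r < N) (if r == p then a *: e p + b *: e q
                   else if r == q then c *: e p + d *: e q else e r).

Lemma delta_block_mx2 (a b c d : R) (r : 'I_N) :
  e r *m block_mx2 a b c d = (if r == p then a *: e p + b *: e q
                   else if r == q then c *: e p + d *: e q else e r).
Proof. by rewrite -rowE rowK. Qed.

Lemma block_mx2_orthogonal (a b c d : R) :
  a ^+ 2 + b ^+ 2 = 1 -> c ^+ 2 + d ^+ 2 = 1 -> a * c + b * d = 0 ->
  orthogonal_mx (block_mx2 a b c d).
Proof.
move=> h1 h2 h3; apply/matrixP => r s.
(* The entry is the inner product of rows [r] and [s], which bilinearity reduces to inner products
   of basis vectors. *)
have -> : (block_mx2 a b c d *m (block_mx2 a b c d)^T) r s =
  ((e r *m block_mx2 a b c d) *m (e s *m block_mx2 a b c d)^T) 0 0.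
  rewrite trmx_mul trmx_delta mulmxA -(mulmxA (e r)) -colE -rowE.
  by rewrite [RHS]mxE [RHS]mxE.
rewrite !delta_block_mx2 [RHS]mxE.
have dE u v : ((e u : 'rV[R]_N) *m (e v : 'rV[R]_N)^T) 0 0 = (u == v)%:R.
  by rewrite trmx_delta mul_delta_mx_cond mulmxnE mxE !eqxx; case: (u == v).
have dD (u u' w : 'rV[R]_N) x y : ((x *: u + y *: u') *m w^T) 0 0 =
   x * (u *m w^T) 0 0 + y * (u' *m w^T) 0 0.
  by rewrite mulmxDl -!scalemxAl !mxE.
have dD' (u u' w : 'rV[R]_N) x y : (w *m (x *: u + y *: u')^T) 0 0 =
   x * (w *m u^T) 0 0 + y * (w *m u'^T) 0 0.
  by rewrite linearD !linearZ /= mulmxDr -!scalemxAr !mxE.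
have qp : (q == p) = false by rewrite eq_sym (negbTE pq).
have pq' := negbTE pq.
case: (r =P p) => [->|/eqP rp]; case: (s =P p) => [->|/eqP sp]; rewrite ?eqxx ?qp ?pq'.
- by rewrite dD !dD' !dE !eqxx pq' qp /=; move: h1; rewrite !expr2; lra.
- case: (s =P q) => [->|/eqP sq].
    by rewrite dD !dD' !dE !eqxx pq' qp /=; lra.
  by rewrite dD !dE !(eq_sym _ s) (negbTE sp) (negbTE sq) /=; lra.
- case: (r =P q) => [->|/eqP rq].
    by rewrite dD !dD' !dE !eqxx pq' qp /=; lra.
  by rewrite dD' !dE (negbTE rp) (negbTE rq) /=; lra.
case: (r =P q) => [->|/eqP rq]; case: (s =P q) => [->|/eqP sq]; rewrite ?eqxx.
- by rewrite dD !dD' !dE !eqxx pq' qp /=; move: h2; rewrite !expr2; lra.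
- by rewrite dD !dE !(eq_sym _ s) (negbTE sp) (negbTE sq) /=; lra.
- by rewrite dD' !dE (negbTE rp) (negbTE rq) /=; lra.
- by rewrite dE.
Qed.

End BlockOrthogonal.

(* A rotation by 45 degrees in the (p, q)-plane expands F p p p p into all 16
   values of F on {p, q}^4; the odd ones vanish by the reflection p |-> -p, and
   the even ones come in pairs exchanged by p <-> q. *)
Lemma multilinear_four_split (R : realType) (V : lmodType R) (F : V -> V -> V -> V -> R)
    (p q : V) :
  (forall r1 r2 u u' w2 w3 w4,
    F (r1 *: u + r2 *: u') w2 w3 w4 = r1 * F u w2 w3 w4 + r2 * F u' w2 w3 w4) ->
  (forall r1 r2 u u' w1 w3 w4,
    F w1 (r1 *: u + r2 *: u') w3 w4 = r1 * F w1 u w3 w4 + r2 * F w1 u' w3 w4) ->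
  (forall r1 r2 u u' w1 w2 w4,
    F w1 w2 (r1 *: u + r2 *: u') w4 = r1 * F w1 w2 u w4 + r2 * F w1 w2 u' w4) ->
  (forall r1 r2 u u' w1 w2 w3,
    F w1 w2 w3 (r1 *: u + r2 *: u') = r1 * F w1 w2 w3 u + r2 * F w1 w2 w3 u') ->
  (forall r1 r2 r3 r4 : R,
    r1 ^+ 2 + r2 ^+ 2 = 1 -> r3 ^+ 2 + r4 ^+ 2 = 1 -> r1 * r3 + r2 * r4 = 0 ->
    forall b1 b2 b3 b4 : bool,
    let v (b : bool) := if b then p else q in
    let w (b : bool) := if b then r1 *: p + r2 *: q else r3 *: p + r4 *: q in
    F (w b1) (w b2) (w b3) (w b4) = F (v b1) (v b2) (v b3) (v b4)) ->
  F q q q q = F p p q q + F p q p q + F p q q p.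
Proof.
move=> l1 l2 l3 l4 inv.
pose h : R := Num.sqrt 2^-1.
have hh : h * h = 2^-1 by rewrite -expr2 sqr_sqrtr // invr_ge0.
have ho : h ^+ 2 + h ^+ 2 = 1 by rewrite expr2 hh; field.
have ho' : h ^+ 2 + (- h) ^+ 2 = 1 by rewrite sqrrN.
have ho0 : h * h + h * - h = 0 by rewrite mulrN subrr.
have rot := inv _ _ _ _ ho ho' ho0 true true true true.
have s1 : (- 1) ^+ 2 + 0 ^+ 2 = 1 :> R by ring.
have s2 : 0 ^+ 2 + 1 ^+ 2 = 1 :> R by ring.
have s3 : - 1 * 0 + 0 * 1 = 0 :> R by ring.
have sgn := inv _ _ _ _ s1 s2 s3.
have t2 : 1 ^+ 2 + 0 ^+ 2 = 1 :> R by ring.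
have t3 : 0 * 1 + 1 * 0 = 0 :> R by ring.
have swp := inv _ _ _ _ s2 t2 t3.
have o1 := sgn true true true false; have o2 := sgn true true false true.
have o3 := sgn true false true true; have o4 := sgn false true true true.
have o5 := sgn false false false true; have o6 := sgn false false true false.
have o7 := sgn false true false false; have o8 := sgn true false false false.
have p1 := swp true true true true; have p2 := swp true true false false.
have p3 := swp true false true false; have p4 := swp true false false true.
move: rot o1 o2 o3 o4 o5 o6 o7 o8 p1 p2 p3 p4.
rewrite /= !(l1, l2, l3, l4) !(mul0r, mul1r, addr0, add0r, mulr0).
have h4 z : h * (h * (h * (h * z))) = 4^-1 * z.
  by have -> : 4^-1 = h * h * (h * h) :> R; [rewrite hh; field | rewrite !mulrA].
(* With S the right-hand side of the goal, what remains is 4 F(q,q,q,q) = 2 F(q,q,q,q) + 2 S. *)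
rewrite !mulrDr !h4; lra.
Qed.

(** * Moments of entries and their invariance under the orthogonal group *)

Section Moments.

Variables (R : realType) (k M N : nat) (mu : probability (MxSpace R N) R).
Hypothesis haar : haar_A M mu.

Local Notation e := (delta_mx (0 : 'I_1)).

(** Polarised form of [entry_prod]: with vectors in place of indices the moment is multilinear, so
    rotations can be expanded. Only [j] varies, while [k] is fixed, so that permutations of the
    points keep one type. *)
Definition form_prod (j : nat) (v : 'I_(2 * k) -> 'rV[R]_N) (A : MxSpace R N) : R :=
  \prod_(l < k | (l < j)%N) (v (ofst l) *m (A : 'M[R]_N) *m (v (osnd l))^T) 0 0.

Definition entry_prod (j : nat) (c : 'I_(2 * k) -> 'I_N) (A : MxSpace R N) : R :=
  \prod_(l < k | (l < j)%N) (A : 'M[R]_N) (c (ofst l)) (c (osnd l)).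

Definition vmom j v := expect mu (form_prod j v).

Definition cmom j c := expect mu (entry_prod j c).

Lemma bounded_obs_entry_prod j c : bounded_obs M (entry_prod j c).
Proof. by apply: bounded_obs_prod => l _; exact: bounded_obs_entry. Qed.

Lemma bounded_obs_form_prod j v : bounded_obs M (form_prod j v).
Proof.
apply: bounded_obs_prod => l _.
rewrite (_ : (fun _ => _) = fun A : MxSpace R N =>
  \sum_t (\sum_s v (ofst l) 0 s * (A : 'M[R]_N) s t) * v (osnd l) 0 t).
  apply: bounded_obs_sum => t _; apply: bounded_obsM; last exact: bounded_obs_cst.
  apply: bounded_obs_sum => s _; apply: bounded_obsM; first exact: bounded_obs_cst.
  exact: bounded_obs_entry.
by apply/funext => A; rewrite mxE; apply: eq_bigr => t _; rewrite !mxE.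
Qed.

Lemma cmomE j c : cmom j c = vmom j (fun s => e (c s)).
Proof.
congr expect; apply/funext => A; apply: eq_bigr => l _.
by rewrite -rowE trmx_delta -colE !mxE.
Qed.

Lemma eq_vmom j v v' : (forall s : 'I_(2 * k), (s < 2 * j)%N -> v s = v' s) -> vmom j v = vmom j v'.
Proof.
move=> h; congr expect; apply/funext => A; apply: eq_bigr => l lj.
by rewrite !h //=; lia.
Qed.

Lemma eq_cmom j c c' : (forall s : 'I_(2 * k), (s < 2 * j)%N -> c s = c' s) -> cmom j c = cmom j c'.
Proof. by move=> h; rewrite !cmomE; apply: eq_vmom => s sj; rewrite h. Qed.

Lemma vmom_orthogonal j v O : orthogonal_mx O -> vmom j (fun s => v s *m O) = vmom j v.
Proof.
move=> OO; rewrite /vmom -(expect_conj haar OO (bounded_obs_form_prod j v)).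
congr expect; apply/funext => A; apply: eq_bigr => l _.
by rewrite /conj_mx trmx_mul !mulmxA.
Qed.

(** The position [a] occurs in exactly one factor, as the left or the right vector of a bilinear
    form; the other factors are common to all three products. *)
Lemma vmom_linear j (a : 'I_(2 * k)) (x y : R) v u w : (a < 2 * j)%N ->
  (forall s, s != a -> u s = v s /\ w s = v s) -> v a = x *: u a + y *: w a ->
  vmom j v = x * vmom j u + y * vmom j w.
Proof.
move=> aj uvw va.
rewrite /vmom -!(expectZ haar) -?(expectD haar); try by [
  exact: bounded_obs_form_prod |
  apply: bounded_obsM; [exact: bounded_obs_cst|exact: bounded_obs_form_prod]].
congr expect; apply/funext => A; rewrite /form_prod.
have [l [al|al]] := position_cases a; subst a.
- have lj : (l < j)%N by move: aj => /=; lia.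
  rewrite !(bigD1 l lj) /=.
  have E f : (forall s, s != ofst l -> f s = v s) ->
    \prod_(i < k | (i < j)%N && (i != l))
       (f (ofst i) *m (A : 'M[R]_N) *m (f (osnd i))^T) 0 0 =
    \prod_(i < k | (i < j)%N && (i != l))
       (v (ofst i) *m (A : 'M[R]_N) *m (v (osnd i))^T) 0 0.
    move=> fv; apply: eq_bigr => i /andP[_ il].
    by rewrite !fv // ?osnd_neq_ofst // (inj_eq (@ofst_inj _)).
  rewrite (E u) ?(E w) => [|s /uvw[]//|s /uvw[]//].
  have sne : osnd l != ofst l by rewrite osnd_neq_ofst.
  rewrite (uvw _ sne).1 (uvw _ sne).2 va !mulmxDl -!scalemxAl !mxE.
  by rewrite mulrDl !mulrA.
- have lj : (l < j)%N by move: aj => /=; lia.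
  rewrite !(bigD1 l lj) /=.
  have E f : (forall s, s != osnd l -> f s = v s) ->
    \prod_(i < k | (i < j)%N && (i != l))
       (f (ofst i) *m (A : 'M[R]_N) *m (f (osnd i))^T) 0 0 =
    \prod_(i < k | (i < j)%N && (i != l))
       (v (ofst i) *m (A : 'M[R]_N) *m (v (osnd i))^T) 0 0.
    move=> fv; apply: eq_bigr => i /andP[_ il].
    by rewrite !fv // ?ofst_neq_osnd // (inj_eq (@osnd_inj _)).
  rewrite (E u) ?(E w) => [|s /uvw[]//|s /uvw[]//].
  have sne : ofst l != osnd l by rewrite ofst_neq_osnd.
  rewrite (uvw _ sne).1 (uvw _ sne).2 va linearD !linearZ /= mulmxDr -!scalemxAr !mxE.
  by rewrite mulrDl !mulrA.
Qed.

(** The matrix exchanging two basis vectors is orthogonal, so only the pattern of equal colours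
    matters, not their names. *)
Lemma cmom_swap j c p q : cmom j (tperm p q \o c) = cmom j c.
Proof.
have [->|pq] := eqVneq p q; first by apply: eq_cmom => s _; rewrite /= tperm1 perm1.
rewrite !cmomE -(vmom_orthogonal j (fun s => e (c s))
  (block_mx2_orthogonal pq (a := 0) (b := 1) (c := 1) (d := 0) _ _ _)); try by ring.
apply: eq_vmom => s _; rewrite delta_block_mx2 /=.
case: tpermP => [->|->|/eqP/negbTE -> /eqP/negbTE -> //].
  by rewrite eqxx scale0r scale1r add0r.
by rewrite eq_sym (negbTE pq) eqxx scale0r scale1r addr0.
Qed.

(** * Splitting a moment in which four indices coincide *)

Section Merge.

Variables (j : nat) (c : 'I_(2 * k) -> 'I_N) (x y a b : 'I_(2 * k)) (p q : 'I_N).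
Hypothesis dist : uniq [:: x; y; a; b].
Hypotheses (xj : (x < 2 * j)%N) (yj : (y < 2 * j)%N) (aj : (a < 2 * j)%N)
  (bj : (b < 2 * j)%N).
Hypothesis pq : p != q.
Hypothesis other : forall s : 'I_(2 * k), (s < 2 * j)%N -> s \notin [:: x; y; a; b] ->
  (c s != p) && (c s != q).

(** Freeing four positions turns the moment into a 4-linear form. By [other], the vectors left at
    the remaining relevant positions are fixed by every rotation of the (p, q)-plane, so this form
    is invariant under such rotations. *)
Definition slots (w1 w2 w3 w4 : 'rV[R]_N) (s : 'I_(2 * k)) : 'rV[R]_N :=
  if s == x then w1 else if s == y then w2 else if s == a then w3
  else if s == b then w4 else e (c s).

Local Notation T w1 w2 w3 w4 := (vmom j (slots w1 w2 w3 w4)).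

Lemma slot_linear1 r1 r2 u u' w2 w3 w4 :
  T (r1 *: u + r2 *: u') w2 w3 w4 = r1 * T u w2 w3 w4 + r2 * T u' w2 w3 w4.
Proof.
apply: (@vmom_linear _ x) => // [s /negbTE sx|]; rewrite /slots; last by rewrite eqxx.
by rewrite sx.
Qed.

Lemma slot_linear2 r1 r2 u u' w1 w3 w4 :
  T w1 (r1 *: u + r2 *: u') w3 w4 = r1 * T w1 u w3 w4 + r2 * T w1 u' w3 w4.
Proof.
apply: (@vmom_linear _ y) => // [s /negbTE sx|]; rewrite /slots ?sx //.
move: dist; rewrite /= !inE !negb_or -!andbA => /and4P[xy _ _ _].
by rewrite eq_sym (negbTE xy) eqxx.
Qed.

Lemma slot_linear3 r1 r2 u u' w1 w2 w4 :
  T w1 w2 (r1 *: u + r2 *: u') w4 = r1 * T w1 w2 u w4 + r2 * T w1 w2 u' w4.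
Proof.
apply: (@vmom_linear _ a) => // [s /negbTE sx|]; rewrite /slots ?sx //.
move: dist; rewrite /= !inE !negb_or -!andbA => /and5P[_ xa _ ya _].
by rewrite !(eq_sym a) (negbTE xa) (negbTE ya) eqxx.
Qed.

Lemma slot_linear4 r1 r2 u u' w1 w2 w3 :
  T w1 w2 w3 (r1 *: u + r2 *: u') = r1 * T w1 w2 w3 u + r2 * T w1 w2 w3 u'.
Proof.
apply: (@vmom_linear _ b) => // [s /negbTE sx|]; rewrite /slots ?sx //.
move: dist; rewrite /= !inE !negb_or -!andbA => /and5P[_ _ xb _ /andP[yb /andP[ab _]]].
by rewrite !(eq_sym b) (negbTE xb) (negbTE yb) (negbTE ab) eqxx.
Qed.

Lemma slots_block (r1 r2 r3 r4 : R) w1 w2 w3 w4 :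
  r1 ^+ 2 + r2 ^+ 2 = 1 -> r3 ^+ 2 + r4 ^+ 2 = 1 -> r1 * r3 + r2 * r4 = 0 ->
  let O := block_mx2 p q r1 r2 r3 r4 in
  T (w1 *m O) (w2 *m O) (w3 *m O) (w4 *m O) = T w1 w2 w3 w4.
Proof.
move=> h1 h2 h3 O.
rewrite -[RHS](vmom_orthogonal j _ (block_mx2_orthogonal pq h1 h2 h3)).
apply: eq_vmom => s sj; rewrite /slots.
case: (s =P x) => [//|/eqP sx]; case: (s =P y) => [//|/eqP sy].
case: (s =P a) => [//|/eqP sa]; case: (s =P b) => [//|/eqP sb].
have /andP[/negbTE sp /negbTE sq] : (c s != p) && (c s != q).
  by apply: other => //; rewrite !inE !negb_or sx sy sa sb.
by rewrite delta_block_mx2 sp sq.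
Qed.

Lemma four_split :
  T (e q) (e q) (e q) (e q) =
  T (e p) (e p) (e q) (e q) + T (e p) (e q) (e p) (e q) + T (e p) (e q) (e q) (e p).
Proof.
apply: (multilinear_four_split (F := fun w1 w2 w3 w4 => T w1 w2 w3 w4)).
- exact: slot_linear1.
- exact: slot_linear2.
- exact: slot_linear3.
- exact: slot_linear4.
move=> r1 r2 r3 r4 h1 h2 h3 b1 b2 b3 b4 /=.
have qp : (q == p) = false by rewrite eq_sym (negbTE pq).
rewrite -[RHS](slots_block _ _ _ _ h1 h2 h3).
have vO (d : bool) : (if d then e p else e q : 'rV[R]_N) *m block_mx2 p q r1 r2 r3 r4 =
    if d then r1 *: e p + r2 *: e q else r3 *: e p + r4 *: e q.
  by case: d; rewrite delta_block_mx2 ?eqxx ?qp.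
by rewrite !vO.
Qed.

End Merge.

End Moments.

(** * Colourings whose fibres are pairs *)

Section Pairings.

Variables (k : nat) (T : eqType).
Implicit Types c : 'I_(2 * k) -> T.

Definition partner c (a b : 'I_(2 * k)) : Prop :=
  b != a /\ forall s, (c s == c a) = (s == a) || (s == b).

Definition pairing c : Prop := forall a, exists b, partner c a b.

(** For a pairing, this says that its pair partition contains the blocks of [e_part k] from index
    [j] on; [closed_from 0] characterises [e_part k] itself. *)
Definition closed_from (j : nat) c : bool :=
  [forall l : 'I_k, (j <= l)%N ==> (c (ofst l) == c (osnd l))].

Lemma closed_fromP j c :
  reflect (forall l : 'I_k, (j <= l)%N -> c (ofst l) = c (osnd l)) (closed_from j c).
Proof.
apply: (iffP forallP) => h l; first by move/implyP: (h l) => h' /h'/eqP.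
by apply/implyP => /h ->.
Qed.

Lemma pairing_perm c (s : {perm 'I_(2 * k)}) : pairing c -> pairing (c \o s).
Proof.
move=> pc a; have [b [ba hb]] := pc (s a).
exists ((s^-1)%g b); split; first by apply: contra_neq ba => <-; rewrite permKV.
move=> u; rewrite /= hb (inj_eq perm_inj); congr (_ || _).
by apply/eqP/eqP => [<-|->]; rewrite ?permK ?permKV.
Qed.

Lemma partner_color c a b : partner c a b -> c b = c a.
Proof. by move=> [_ h]; apply/eqP; rewrite h eqxx orbT. Qed.

(** If [b] were at least [2 * j], the other point of its block would have the same colour, hence
    would be [a], which lies below [2 * j]. *)
Lemma partner_lt j c (a b : 'I_(2 * k)) :
  closed_from j c -> partner c a b -> (a < 2 * j)%N -> (b < 2 * j)%N.
Proof.
move=> /closed_fromP cl pab aj; rewrite ltnNge; apply/negP => bj.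
have [ba h] := pab; have cb := partner_color pab.
have [l [bl|bl]] := position_cases b; subst b.
  have := h (osnd l); rewrite -cl; last by move: bj => /=; lia.
  rewrite cb eqxx osnd_neq_ofst orbF => /esym/eqP al.
  by move: aj; rewrite -al /=; move: bj => /=; lia.
have := h (ofst l); rewrite cl; last by move: bj => /=; lia.
rewrite cb eqxx ofst_neq_osnd orbF => /esym/eqP al.
by move: aj; rewrite -al /=; move: bj => /=; lia.
Qed.

Lemma closed_from_tperm j c (a b : 'I_(2 * k)) : (a < 2 * j)%N -> (b < 2 * j)%N ->
  closed_from j (c \o tperm a b) = closed_from j c.
Proof.
move=> aj bj; apply: eq_forallb => l; case: (leqP j l) => //= jl.
by rewrite !tpermD // -(inj_eq val_inj) /=; lia.
Qed.

Lemma closed_fromS (j : 'I_k) c :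
  closed_from j c = (c (ofst j) == c (osnd j)) && closed_from j.+1 c.
Proof.
apply/closed_fromP/andP => [h|[/eqP h /closed_fromP h'] l].
  by split; [rewrite h | apply/closed_fromP => l jl; apply: h; exact: ltnW].
by rewrite leq_eqVlt => /orP[/eqP/val_inj <-//|]; exact: h'.
Qed.

End Pairings.

(** * The recursion for the moments *)

Section Recursion.

Variables (R : realType) (k M N : nat) (mu : probability (MxSpace R N) R).
Hypothesis haar : haar_A M mu.

Local Notation e := (delta_mx (0 : 'I_1)).
Local Notation cmom := (@cmom R k N mu).

Definition recolour (p q : 'I_N) (c : 'I_(2 * k) -> 'I_N) (s : 'I_(2 * k)) : 'I_N :=
  if c s == p then q else c s.

(** After recolouring, [x], [y], [a], [b] share one colour, and [four_split] produces the three ways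
    of pairing these four positions. *)
Lemma cmom_merge j c (x y a b : 'I_(2 * k)) : (x < 2 * j)%N -> (a < 2 * j)%N -> closed_from j c ->
  partner c x y -> partner c a b -> c x != c a ->
  cmom j (recolour (c x) (c a) c) =
  cmom j c + cmom j (c \o tperm a x) + cmom j (c \o tperm b x).
Proof.
move=> xj aj cl pxy pab pq.
have yj := partner_lt cl pxy xj; have bj := partner_lt cl pab aj.
have [yx hx] := pxy; have [ba ha] := pab.
have cy := partner_color pxy; have cb := partner_color pab.
have nxa : x != a by apply: contra_neq pq => ->.
have nxb : x != b by apply: contra_neq pq => ->.
have nya : y != a by apply: contra_neq pq => <-; rewrite cy.
have nyb : y != b by apply: contra_neq pq => nyb; rewrite -cy -cb nyb.
have dist : uniq [:: x; y; a; b].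
  by rewrite /= !inE !negb_or (eq_sym x y) yx nxa nxb nya nyb (eq_sym a b) ba.
have other (s : 'I_(2 * k)) : (s < 2 * j)%N -> s \notin [:: x; y; a; b] ->
  (c s != c x) && (c s != c a).
  by rewrite !inE !negb_or => _ /and4P[sx sy sa sb]; rewrite hx ha !negb_or sx sy sa sb.
have := four_split haar dist xj yj aj bj pq other.
have slotsE (z1 z2 z3 z4 : 'I_N) c' :
   c' x = z1 -> c' y = z2 -> c' a = z3 -> c' b = z4 ->
   (forall s, s \notin [:: x; y; a; b] -> c' s = c s) ->
   vmom mu j (slots (R := R) c x y a b (e z1) (e z2) (e z3) (e z4)) = cmom j c'.
  move=> h1 h2 h3 h4 h; rewrite cmomE; apply: eq_vmom => s _; rewrite /slots.
  case: (s =P x) => [->|/eqP sx]; first by rewrite h1.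
  case: (s =P y) => [->|/eqP sy]; first by rewrite h2.
  case: (s =P a) => [->|/eqP sa]; first by rewrite h3.
  case: (s =P b) => [->|/eqP sb]; first by rewrite h4.
  by rewrite h // !inE !negb_or sx sy sa sb.
have nyx := negbTE yx; have nba := negbTE ba.
rewrite (slotsE _ _ _ _ (recolour (c x) (c a) c)); last first.
- move=> s; rewrite !inE !negb_or => /and4P[sx sy _ _].
  by rewrite /recolour hx (negbTE sx) (negbTE sy).
- by rewrite /recolour cb eq_sym (negbTE pq).
- by rewrite /recolour eq_sym (negbTE pq).
- by rewrite /recolour cy eqxx.
- by rewrite /recolour eqxx.
move=> ->; rewrite (slotsE _ _ _ _ c) // -addrA -[RHS]addrA; congr (_ + _).
(* The last two terms of [four_split] arrive in the opposite order, and each agrees with a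
   transposed colouring only after exchanging the two colours. *)
rewrite addrC; congr (_ + _).
  rewrite -(cmom_swap haar _ (c \o tperm a x) (c x) (c a)).
  apply: slotsE => //=.
  - by rewrite tpermR tpermR.
  - by rewrite !(@tpermD _ a x y) 1?eq_sym // cy tpermL.
  - by rewrite !tpermL.
  - by rewrite (@tpermD _ a x b) // 1?eq_sym // cb tpermR.
  - move=> s; rewrite !inE !negb_or => /and4P[sx sy sa sb].
    rewrite (@tpermD _ a x s) 1?eq_sym //.
    by rewrite tpermD // eq_sym ?hx ?ha negb_or ?sx ?sy ?sa ?sb.
rewrite -(cmom_swap haar _ (c \o tperm b x) (c x) (c a)).
apply: slotsE => //=.
- by rewrite tpermR cb tpermR.
- by rewrite (@tpermD _ b x y) 1?eq_sym // cy tpermL.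
- by rewrite (@tpermD _ b x a) // 1?eq_sym // tpermR.
- by rewrite !tpermL.
- move=> s; rewrite !inE !negb_or => /and4P[sx sy sa sb].
    rewrite (@tpermD _ b x s) 1?eq_sym //.
  by rewrite tpermD // eq_sym ?hx ?ha negb_or ?sx ?sy ?sa ?sb.
Qed.

(** One formula covers three cases. For [q = c x] nothing changes. If [q] does not occur below
    [2 * j], recolouring acts there as an exchange of colour names. Otherwise the sum has two terms,
    a point of colour [q] and its partner, as in [cmom_merge]. *)
Lemma cmom_recolour j c (x : 'I_(2 * k)) q : (x < 2 * j)%N -> closed_from j c -> pairing c ->
  cmom j (recolour (c x) q c) = cmom j c +
  \sum_(a : 'I_(2 * k) | [&& (a < 2 * j)%N, c a != c x & c a == q]) cmom j (c \o tperm a x).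
Proof.
move=> xj cl pc.
have [->|qx] := eqVneq q (c x).
  rewrite big_pred0 ?addr0 => [|a]; last by case: (c a == c x); rewrite !andbF.
  by apply: eq_cmom => s _; rewrite /recolour; case: eqP => // ->.
have [/existsP[a /andP[aj /eqP ca]]|none] :=
  boolP [exists a : 'I_(2 * k), (a < 2 * j)%N && (c a == q)]; last first.
  rewrite big_pred0 ?addr0 => [|a].
    rewrite -[RHS](cmom_swap haar _ c (c x) q); apply: eq_cmom => s sj.
    rewrite /recolour /=; case: tpermP => [->|csq|/eqP/negbTE -> //].
      by rewrite eqxx.
    by case/negP: none; apply/existsP; exists s; rewrite sj csq eqxx.
  apply/negP => /and3P[aj _ cq]; case/negP: none; apply/existsP; exists a.
  by rewrite aj cq.
subst q; have [y py] := pc x; have [b pb] := pc a.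
have [ba ha] := pb; have bj := partner_lt cl pb aj.
rewrite (cmom_merge xj aj cl py pb) 1?eq_sym // -addrA; congr (_ + _).
rewrite (bigD1 a) /= ?aj ?qx ?eqxx //; congr (_ + _).
rewrite (bigD1 b) /= ?bj ?(partner_color pb) ?qx ?eqxx //.
rewrite big_pred0 ?addr0 // => s; rewrite ha.
by case: (s == a); case: (s == b); rewrite ?andbF.
Qed.

(** Each position [a] contributes for exactly one [q], its own colour. *)
Lemma sum_cmom_recolour j c (x : 'I_(2 * k)) : (x < 2 * j)%N -> closed_from j c -> pairing c ->
  \sum_q cmom j (recolour (c x) q c) = N%:R * cmom j c +
  \sum_(a : 'I_(2 * k) | (a < 2 * j)%N && (c a != c x)) cmom j (c \o tperm a x).
Proof.
move=> xj cl pc.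
under eq_bigr do rewrite (cmom_recolour _ xj cl pc).
rewrite big_split /= sumr_const card_ord mulr_natl; congr (_ + _).
rewrite [RHS](partition_big c predT) //=; apply: eq_bigr => q _.
by apply: eq_bigl => a; rewrite andbA.
Qed.

Lemma cmom_tperm_pair (l : 'I_k) j c : cmom j (c \o tperm (osnd l) (ofst l)) = cmom j c.
Proof.
apply: (eq_expect haar); [exact: bounded_obs_entry_prod..|] => A [At _].
apply: eq_bigr => i _ /=; have [->|il] := eqVneq i l.
  by rewrite tpermL tpermR -{1}At mxE.
by rewrite !tpermD // ?ofst_neq_osnd ?osnd_neq_ofst //
  ?(inj_eq (@ofst_inj _)) ?(inj_eq (@osnd_inj _)) // eq_sym.
Qed.

Lemma entry_prodS (j : 'I_k) c (A : MxSpace R N) :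
  entry_prod j.+1 c A = (A : 'M[R]_N) (c (ofst j)) (c (osnd j)) * entry_prod j c A.
Proof.
rewrite /entry_prod (bigD1 j) //=; congr (_ * _); apply: eq_bigl => l.
by rewrite ltnS -(inj_eq val_inj) /= (ltn_neqAle l j) andbC.
Qed.

(** The colour of the last pair occurs nowhere else, so recolouring affects only the last entry, and
    the diagonal entries sum to the trace, which is the rank [M]. *)
Lemma sum_trace_contract (j : 'I_k) c : pairing c -> c (ofst j) = c (osnd j) ->
  \sum_q cmom j.+1 (recolour (c (ofst j)) q c) = M%:R * cmom j c.
Proof.
move=> pc cj.
have [b pb] := pc (ofst j); have [ba hb] := pb.
have eb : b = osnd j.
  by move/eqP: cj; rewrite eq_sym hb osnd_neq_ofst => /eqP.
rewrite /cmom -(expect_sum haar) => [|q]; last exact: bounded_obs_entry_prod.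
rewrite -(expectZ haar); last exact: bounded_obs_entry_prod.
apply: (eq_expect haar).
- by apply: bounded_obs_sum => q _; exact: bounded_obs_entry_prod.
- by apply: bounded_obsM; [exact: bounded_obs_cst | exact: bounded_obs_entry_prod].
move=> A [At [AA rA]]; rewrite -rA -(mxtrace_idempotent AA) /mxtrace mulr_suml.
apply: eq_bigr => q _; rewrite entry_prodS /recolour eqxx cj eqxx; congr (_ * _).
apply: eq_bigr => l lj; rewrite -cj !hb eb.
by rewrite osnd_neq_ofst ofst_neq_osnd (inj_eq (@ofst_inj _)) (inj_eq (@osnd_inj _))
   orbF -(inj_eq val_inj) /= ltn_eqF.
Qed.

(** The summed colour occurs once in the last entry and once at [u]; [A *m A = A] fuses these two
    entries into one, in which [u] carries the colour of [osnd j]. *)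
Lemma sum_square_contract (j : 'I_k) c (u d : 'I_(2 * k)) :
  partner c (ofst j) u -> partner c (osnd j) d ->
  c (ofst j) != c (osnd j) -> (u < 2 * j)%N -> (d < 2 * j)%N ->
  \sum_q cmom j.+1 (recolour (c (ofst j)) q c) = cmom j (c \o tperm d (ofst j)).
Proof.
move=> pu pd cj uj dj.
set p := c (ofst j); set p' := c (osnd j).
have [nu hu] := pu; have [nd hd] := pd.
have cu := partner_color pu; have cd := partner_color pd.
have nud : d != u by apply: contra_neq cj => du; rewrite -cu -cd du.
have ltj (s : 'I_(2 * k)) : (s < 2 * j)%N -> (s == ofst j = false) * (s == osnd j = false).
  by move=> sj; split; apply/negP => /eqP/(congr1 val) /=; lia.
(* Below [2 * j], the transposed colouring gives [p] to both [u] and [d]; exchanging [p] and [p']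
   yields [c] with [u] recoloured to [p']. *)
rewrite -(cmom_swap haar _ _ p p').
transitivity (cmom j (fun s => if s == u then p' else c s)); last first.
  apply: eq_cmom => s sj /=; have [->|su] := eqVneq s u.
    by rewrite (@tpermD _ d (ofst j) u) // 1?eq_sym // cu tpermL.
  have [->|sd] := eqVneq s d; first by rewrite tpermL tpermL cd.
  rewrite (@tpermD _ d (ofst j) s) 1?eq_sym ?(ltj s sj) //.
  by rewrite tpermD // eq_sym ?hu ?hd !(ltj s sj) ?(negbTE su) ?(negbTE sd).
rewrite /cmom -(expect_sum haar) => [|q]; last exact: bounded_obs_entry_prod.
apply: (eq_expect haar).
- by apply: bounded_obs_sum => q _; exact: bounded_obs_entry_prod.
- exact: bounded_obs_entry_prod.
move=> A [At [AA rA]].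
have rE q (s : 'I_(2 * k)) : (s < 2 * j)%N -> recolour p q c s = if s == u then q else c s.
  by move=> sj; rewrite /recolour hu (ltj s sj).
have sumA r s : \sum_q (A : 'M[R]_N) r q * (A : 'M[R]_N) q s = (A : 'M[R]_N) r s.
  by rewrite -[in RHS]AA mxE.
have symA r s : (A : 'M[R]_N) r s = (A : 'M[R]_N) s r by rewrite -[in LHS]At mxE.
under eq_bigr => q _.
  rewrite entry_prodS {1 2}/recolour eqxx (eq_sym _ p) (negbTE cj).
  over.
have [l lu] := position_cases u.
have lj : (l < j)%N by case: lu uj => -> /=; lia.
have rest f g :
   (forall s : 'I_(2 * k), s != u -> (s < 2 * j)%N -> f s = c s) ->
   (forall s : 'I_(2 * k), s != u -> (s < 2 * j)%N -> g s = c s) ->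
   \prod_(i < k | (i < j)%N && (i != l)) (A : 'M[R]_N) (f (ofst i)) (f (osnd i)) =
   \prod_(i < k | (i < j)%N && (i != l)) (A : 'M[R]_N) (g (ofst i)) (g (osnd i)) :> R.
  move=> hf hg; apply: eq_bigr => i /andP[ij il].
  have nf : ofst i != u.
    by case: lu => ->; rewrite ?(inj_eq (@ofst_inj _)) ?ofst_neq_osnd.
  have ns : osnd i != u.
    by case: lu => ->; rewrite ?(inj_eq (@osnd_inj _)) ?osnd_neq_ofst.
  by rewrite !hf ?hg //=; lia.
rewrite /entry_prod (bigD1 l lj) /=.
under eq_bigr => q _.
  rewrite (bigD1 l lj) /= (rest (recolour p q c) (fun s => if s == u then p' else c s));
    [|by move=> s su sj; rewrite rE // (negbTE su)|by move=> s su sj; rewrite (negbTE su)].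
  rewrite mulrA !rE /=; [|lia|lia].
  over.
rewrite -mulr_suml; congr (_ * _).
case: lu => ->; rewrite eqxx ?osnd_neq_ofst ?ofst_neq_osnd.
  by under eq_bigr do rewrite symA; rewrite sumA.
by under eq_bigr do rewrite mulrC; rewrite sumA.
Qed.

Lemma cmom_recursion (j : 'I_k) c : closed_from j.+1 c -> pairing c ->
  let cm' c := if c (ofst j) == c (osnd j) then cmom j c else 0 in
  N%:R * cmom j.+1 c +
    \sum_(a : 'I_(2 * k) | (a < 2 * j)%N) cmom j.+1 (c \o tperm a (ofst j)) =
  M%:R * cm' c + \sum_(a : 'I_(2 * k) | (a < 2 * j)%N) cm' (c \o tperm a (ofst j)).
Proof.
move=> cl pc cm'.
have fj : (ofst j < 2 * j.+1)%N by rewrite /=; lia.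
have sj : (osnd j < 2 * j.+1)%N by rewrite /=; lia.
have S := sum_cmom_recolour fj cl pc.
have [u pu] := pc (ofst j); have [d pd] := pc (osnd j).
have [nu hu] := pu; have [nd hd] := pd.
have lt2 (a : 'I_(2 * k)) : (a < 2 * j.+1)%N =
    [|| (a < 2 * j)%N, a == ofst j | a == osnd j].
  by rewrite -!(inj_eq val_inj) /=; lia.
have ltj (s : 'I_(2 * k)) : (s < 2 * j)%N -> (s == ofst j = false) * (s == osnd j = false).
  by move=> sj'; split; apply/negP => /eqP/(congr1 val) /=; lia.
(* The transposition brings the colour of [a] to [ofst j], so the last pair becomes monochromatic
   only when [a] is the partner of [osnd j]. *)
have cm'E (a : 'I_(2 * k)) : (a < 2 * j)%N -> cm' (c \o tperm a (ofst j)) =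
    if a == d then cmom j (c \o tperm a (ofst j)) else 0.
  move=> aj; rewrite /cm' /= tpermR tpermD ?ofst_neq_osnd ?ltj //.
  by rewrite hd !ltj.
(* If the last pair is monochromatic, its partner lies in the pair itself and only the term with [M]
   survives. Otherwise that term is zero and the sum on the right reduces to [a = d]. *)
have [cj|cj] := eqVneq (c (ofst j)) (c (osnd j)).
  have ud : u = osnd j.
    by move/eqP: cj; rewrite eq_sym hu osnd_neq_ofst => /eqP.
  rewrite /cm' cj eqxx -(sum_trace_contract pc cj) S -addrA; congr (_ + _).
  rewrite [X in _ + X]big1 ?addr0 => [|a aj]; last first.
    rewrite -/(cm' _) cm'E //; case: eqP => // ad; subst a.
    have := partner_color pd; rewrite -cj => /eqP; rewrite hu !ltj // ud.
    by rewrite ltj.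
  apply: eq_bigl => a; rewrite lt2 hu ud.
  case: (boolP (a < 2 * j)%N) => [aj|]; first by rewrite !ltj.
  by move=> _ /=; case: (a == ofst j); case: (a == osnd j).
have uj : (u < 2 * j)%N.
  have := partner_lt cl pu fj; rewrite lt2 (negbTE nu) /= => /orP[//|/eqP ud].
  by move: cj; rewrite -ud (partner_color pu) eqxx.
have dj : (d < 2 * j)%N.
  have := partner_lt cl pd sj; rewrite lt2 (negbTE nd) orbF => /orP[//|/eqP ud].
  by move: cj; rewrite -ud (partner_color pd) eqxx.
rewrite /cm' (negbTE cj) mulr0 add0r.
rewrite [RHS](bigD1 d dj) /= [X in _ = _ + X]big1 ?addr0 => [|a /andP[aj ad]]; last first.
  by rewrite -/(cm' (c \o tperm a (ofst j))) cm'E // (negbTE ad).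
rewrite -/(cm' (c \o tperm d (ofst j))) cm'E // eqxx.
rewrite -(sum_square_contract pu pd cj uj dj) S; congr (_ + _).
(* The transposition with the partner of [ofst j] fixes [c]; it stands in for
   the one with [osnd j], which only exchanges the two indices of one entry. *)
rewrite [RHS](bigD1 (osnd j)) /=; last by rewrite sj eq_sym cj.
rewrite (bigD1 u uj) /=; congr (_ + _).
  rewrite cmom_tperm_pair; apply: eq_cmom => s _ /=.
  by case: tpermP => [->|->|//]; rewrite (partner_color pu).
apply: eq_bigl => a; rewrite lt2 hu.
case: (boolP (a < 2 * j)%N) => [aj|]; first by rewrite !ltj //= andbT.
by move=> _ /=; case: (a == ofst j); case: (a == osnd j); rewrite ?andbF.
Qed.

End Recursion.

(** * Sums over monotone factorisations, expanded along the last transposition *)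

Lemma big_tuple_rcons (R : nmodType) (T : finType) (r : nat) (P : pred (seq T))
    (F : seq T -> R) :
  \sum_(s : r.+1.-tuple T | P s) F s =
  \sum_(x : T) \sum_(s : r.-tuple T | P (rcons s x)) F (rcons s x).
Proof.
rewrite pair_big_dep /=.
pose f (z : T * r.-tuple T) : r.+1.-tuple T := [tuple of rcons z.2 z.1].
pose g (s : r.+1.-tuple T) : T * r.-tuple T :=
  (last (thead s) (behead s), [tuple of belast (thead s) (behead s)]).
rewrite (reindex f) //=; exists g => [[x s] _|s _].
  rewrite /g /f /=; have := lastI (thead [tuple of rcons s x]) (behead (rcons s x)).
  have -> : thead [tuple of rcons s x] :: behead (rcons s x) = rcons s x.
    by have := congr1 val (tuple_eta [tuple of rcons s x]).
  move=> /eqP; rewrite eqseq_rcons => /andP[/eqP e1 /eqP e2].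
  by congr pair; [rewrite -e2 | apply: val_inj; rewrite /= -e1].
by apply: val_inj; rewrite /= -lastI [in RHS](tuple_eta s).
Qed.

Section MonotoneSums.

Variables (R : realType) (k : nat) (T : eqType) (t : R).
Implicit Types (c : 'I_(2 * k) -> T) (s : seq ('I_(2 * k) * 'I_(2 * k))).

Definition act_colouring c s : 'I_(2 * k) -> T :=
  foldr (fun ab c' => c' \o transp ab) c s.

Definition mono_below (j : nat) c s : bool :=
  [&& all (fun ab : 'I_(2 * k) * 'I_(2 * k) => (ab.1 < ab.2)%N) s,
      sorted leq (map (fun ab : 'I_(2 * k) * 'I_(2 * k) => nat_of_ord ab.2) s),
      all (fun ab : 'I_(2 * k) * 'I_(2 * k) => odd (nat_of_ord ab.2).+1) s,
      all (fun ab : 'I_(2 * k) * 'I_(2 * k) => (ab.2 < 2 * j)%N) s &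
      closed_from 0 (act_colouring c s)].

(** The value at [t] of the hive polynomial restricted to transpositions within the first [2 * j]
    points; for [j = k] the restriction is vacuous. *)
Definition mono_sum (j r : nat) c : R :=
  \sum_(s : r.-tuple ('I_(2 * k) * 'I_(2 * k)) | mono_below j c s) t ^+ hive s.

Lemma hive_rcons s ab : hive (rcons s ab) = (hive s + (ab.2 \notin map snd s))%N.
Proof.
rewrite /hive map_rcons.
have -> : size (undup (rcons (map snd s) ab.2)) = size (undup (ab.2 :: map snd s)).
  by apply/perm_size/perm_undup => x; rewrite mem_rcons.
by rewrite /=; case: ifP => _ /=; rewrite ?addn0 ?addn1.
Qed.

Lemma act_colouring_rcons c s ab :
  act_colouring c (rcons s ab) = act_colouring (c \o transp ab) s.
Proof. by rewrite /act_colouring -cats1 foldr_cat. Qed.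

Lemma mono_below_rcons j c s ab : mono_below j c (rcons s ab) =
  [&& (ab.1 < ab.2)%N, odd (nat_of_ord ab.2).+1, (ab.2 < 2 * j)%N,
     all (fun ab' : 'I_(2 * k) * 'I_(2 * k) => (ab'.2 <= ab.2)%N) s &
     mono_below j (c \o transp ab) s].
Proof.
rewrite /mono_below !all_rcons act_colouring_rcons map_rcons.
rewrite !sorted_pairwise; try exact: leq_trans.
rewrite pairwise_rcons all_map /=.
apply/idP/idP.
  by move=> /and5P[/andP[-> h1] /andP[h2 ->] /andP[-> ->] /andP[-> ->] ->]; rewrite h1 h2.
by move=> /and5P[-> -> -> h1 /and5P[-> -> -> -> ->]]; rewrite h1.
Qed.

Lemma mono_belowS j c s : mono_below j c s =
  mono_below j.+1 c s &&
  all (fun ab : 'I_(2 * k) * 'I_(2 * k) => (ab.2 < 2 * j)%N) s.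
Proof.
rewrite /mono_below.
have [lt|_] := boolP (all (fun ab : 'I_(2 * k) * 'I_(2 * k) => (ab.2 < 2 * j)%N) s);
  last by rewrite ?andbF.
have -> : all (fun ab : 'I_(2 * k) * 'I_(2 * k) => (ab.2 < 2 * j.+1)%N) s.
  by apply: sub_all lt => ab /= ltj; lia.
by rewrite andbT.
Qed.

Lemma mono_sum0 j c : mono_sum j 0 c = (closed_from 0 c)%:R.
Proof.
rewrite /mono_sum big_mkcond (bigD1 [tuple]) //= big1 ?addr0 => [|s]; last by rewrite tuple0.
by rewrite /mono_below /=; case: (closed_from 0 c).
Qed.

Lemma mono_sum_below0 r c : mono_sum 0 r.+1 c = 0.
Proof.
by rewrite /mono_sum big_pred0 // => s; rewrite (tuple_eta s) /mono_below /= !andbF.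
Qed.

(** If the last transposition does not end at [ofst j], monotonicity keeps the whole sequence below
    [2 * j]. If it does, removing it leaves a sequence counted by [mono_sum j.+1 r]; the term with
    [t - 1] corrects the weight of those in which [ofst j] no longer occurs. *)
Lemma mono_sum_recursion (j : 'I_k) r c :
  mono_sum j.+1 r.+1 c = mono_sum j r.+1 c +
  \sum_(a : 'I_(2 * k) | (a < 2 * j)%N)
     (mono_sum j.+1 r (c \o tperm a (ofst j)) +
      (t - 1) * mono_sum j r (c \o tperm a (ofst j))).
Proof.
rewrite {1 2}/mono_sum.
rewrite (big_tuple_rcons r (mono_below j.+1 c) (fun s => t ^+ hive s)).
rewrite (big_tuple_rcons r (mono_below j c) (fun s => t ^+ hive s)).
rewrite (bigID (fun ab : 'I_(2 * k) * 'I_(2 * k) => ab.2 == ofst j)) /= addrC.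
congr (_ + _).
  rewrite big_mkcond /=; apply: eq_bigr => ab _.
  have [/eqP abj|abj] := boolP (ab.2 == ofst j).
    rewrite /= big_pred0 // => s; rewrite mono_below_rcons abj /= ltnn.
    by rewrite !andbF.
  apply: eq_bigl => s; rewrite [RHS]mono_belowS all_rcons.
  apply/idP/andP => [h|[]//]; split=> //.
  move: h; rewrite mono_below_rcons => /and5P[_ od lt le _].
  have lt' : (ab.2 < 2 * j)%N.
    by move: abj; rewrite -(inj_eq val_inj) /= => /eqP; lia.
  by rewrite lt'; apply: sub_all le => ab' /= /leq_ltn_trans; apply.
transitivity (\sum_(a : 'I_(2 * k)) \sum_(b : 'I_(2 * k) | b == ofst j)
   \sum_(s : r.-tuple ('I_(2 * k) * 'I_(2 * k)) | mono_below j.+1 c (rcons s (a, b)))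
     t ^+ hive (rcons s (a, b))).
  by rewrite [RHS]pair_big_dep /=; apply: eq_big => [[]|[]].
rewrite [RHS]big_mkcond /=; apply: eq_bigr => a _; rewrite big_pred1_eq.
have E s : mono_below j.+1 c (rcons s (a, ofst j)) =
    (a < 2 * j)%N && mono_below j.+1 (c \o tperm a (ofst j)) s.
  rewrite mono_below_rcons /=.
  have -> : ~~ odd (2 * j) by lia.
  have -> : (2 * j < 2 * j.+1)%N by lia.
  case: (a < 2 * j)%N => //=; rewrite andb_idl // => /and5P[_ _ od lt _].
  by apply/allP => ab hab; move/allP: lt => /(_ _ hab); move/allP: od => /(_ _ hab) /=; lia.
case: ifP => aj; last by rewrite big_pred0 // => s; rewrite E aj.
set c' := c \o _.
rewrite /mono_sum mulr_sumr [X in _ = _ + X]big_mkcond [X in _ = X + _]big_mkcond /=.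
rewrite -big_split big_mkcond /=; apply: eq_bigr => s _.
rewrite E aj /= -/c' (mono_belowS j); case: ifP => [ms|_] /=; last by rewrite addr0.
rewrite hive_rcons /=.
(* By parity, [ofst j] is the only admissible larger element among the two points of block [j]. *)
have -> : (ofst j \notin map snd s) =
   all (fun ab : 'I_(2 * k) * 'I_(2 * k) => (ab.2 < 2 * j)%N) s.
  case/and5P: ms => _ _ od lt _; apply/idP/idP => [nj|/allP h].
    apply/allP => ab hab; move/allP: lt => /(_ _ hab); move/allP: od => /(_ _ hab) /= od lt.
    have : (ab.2 != ofst j) by apply: contraNneq nj => <-; exact: map_f.
    by rewrite -(inj_eq val_inj) /= => /eqP; lia.
  by apply/negP => /mapP[ab /h /= lt' abj]; move: lt'; rewrite -abj /= ltnn.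
case: (all _ _) => /=; last by rewrite addn0 addr0.
(* A new hive value multiplies the weight by [t], split as [1 + (t - 1)]. *)
by rewrite addn1 exprS mulrBl mul1r addrC subrK.
Qed.

End MonotoneSums.

(** * From pair partitions to colourings *)

Section FromPartitions.

Variables (k N : nat).
Implicit Types (c : 'I_(2 * k) -> 'I_N) (m : {set {set 'I_(2 * k)}}).

Lemma adaptedP m c :
  reflect (forall a b, a != b -> (c a == c b) = ([set a; b]%SET \in m)) (adapted m c).
Proof.
apply: (iffP forallP) => [h a b ab|h a].
  by have /forallP/(_ b)/implyP/(_ ab)/eqP := h a.
by apply/forallP => b; apply/implyP => ab; rewrite h.
Qed.

Lemma mem_pp_act m (s : {perm 'I_(2 * k)}) a b :
  ([set a; b]%SET \in pp_act s m) = ([set (s^-1)%g a; (s^-1)%g b]%SET \in m).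
Proof.
have -> : [set a; b]%SET = [set s z | z in [set (s^-1)%g a; (s^-1)%g b]%SET]%SET.
  by rewrite imsetU1 imset_set1 !permKV.
by rewrite (mem_imset _ _ (imset_inj (@perm_inj _ s))).
Qed.

Lemma adapted_pp_act m c (ab : 'I_(2 * k) * 'I_(2 * k)) :
  adapted m c -> adapted (pp_act (transp ab) m) (c \o transp ab).
Proof.
move=> /adaptedP h; apply/adaptedP => a b nab; rewrite mem_pp_act /transp tpermV /=.
by rewrite h // (inj_eq perm_inj).
Qed.

Lemma adapted_act_seq m c s : adapted m c -> adapted (act_seq s m) (act_colouring c s).
Proof. by move=> h; elim: s => //= ab s IH; exact: adapted_pp_act. Qed.

Lemma card_pp_act m s B : (forall B, B \in m -> #|B| = 2) -> B \in act_seq s m -> #|B| = 2.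
Proof.
move=> h; elim: s B => //= ab s IH B.
by case/imsetP => C /IH hC ->; rewrite card_imset //; exact: perm_inj.
Qed.

Lemma pairing_adapted m c : pair_partition m -> adapted m c -> pairing c.
Proof.
move=> /andP[pm /forallP c2] /adaptedP h a.
have aC : a \in finset.cover m by rewrite (finset.cover_partition pm) inE.
have Bm := finset.pblock_mem aC; have aB : a \in finset.pblock m a by rewrite finset.mem_pblock.
have := c2 (finset.pblock m a); rewrite Bm /= => /cards2P[x [y [xy Bxy]]].
have tI := finset.partition_trivIset pm.
have [b [ba Bab]] : exists b, b != a /\ finset.pblock m a = [set a; b]%SET.
  move: aB; rewrite Bxy !inE => /orP[]/eqP ->; first by exists y; rewrite eq_sym.
  by exists x; split=> //; rewrite finset.setUC.
exists b; split=> // s; have [->|sa] := eqVneq s a; first by rewrite eqxx.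
rewrite h //=; apply/idP/eqP => [sm|->]; last by rewrite finset.setUC -Bab.
have : finset.pblock m a = [set s; a]%SET by apply: finset.def_pblock => //; rewrite !inE eqxx orbT.
rewrite Bab => /setP/(_ b); rewrite !inE eqxx orbT (negbTE ba) orbF => /esym/eqP ->.
by [].
Qed.

(** An adapted colouring determines the blocks, all of size two. If every pair [ofst l], [osnd l] is
    monochromatic, then a block containing one of the two points must be that pair. *)
Lemma act_seq_e_part m c s : pair_partition m -> adapted m c ->
  (act_seq s m == e_part k) = closed_from 0 (act_colouring c s).
Proof.
move=> ppm am.
have pc := pairing_adapted ppm am.
have am' := adapted_act_seq s am; have /adaptedP h := am'.
have c2 B : B \in act_seq s m -> #|B| = 2.
  move/andP: ppm => [_ /forallP c2]; apply: card_pp_act => C Cm.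
  by have := c2 C; rewrite Cm => /eqP.
have pc' : pairing (act_colouring c s).
  by elim: (s) => //= ab s' IH; exact: pairing_perm.
have ne (l : 'I_k) : ofst l != osnd l by rewrite ofst_neq_osnd.
apply/eqP/closed_fromP => [E l _|cl].
  by apply/eqP; rewrite h // E; apply/imsetP; exists l.
apply/setP => B; apply/idP/imsetP => [Bm|[l _ ->]]; last by rewrite -h // cl.
have /eqP/cards2P[x [y [xy Bxy]]] := c2 B Bm.
have cxy : act_colouring c s x = act_colouring c s y.
  by apply/eqP; rewrite h // -Bxy.
have [b [bx hb]] := pc' x.
have yb : y = b.
  by move/eqP: cxy; rewrite eq_sym hb eq_sym (negbTE xy) => /eqP.
have [l [xl|xl]] := position_cases x; subst x; exists l => //; rewrite Bxy.
  have /eqP := cl l isT; rewrite eq_sym hb osnd_neq_ofst /= => /eqP ->.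
  by rewrite yb.
have /eqP := cl l isT; rewrite hb ofst_neq_osnd /= => /eqP ->.
by rewrite yb finset.setUC.
Qed.

Lemma heval_mono_sum (R : realType) (t : R) m c r : pair_partition m -> adapted m c ->
  heval r m t = mono_sum t k r c.
Proof.
move=> ppm am; rewrite /heval /hpoly rmorph_sum horner_sum.
apply: eq_big => [s|s _]; last by rewrite rmorphXn /= map_polyX hornerXn.
rewrite /monotone_fact /mono_below (act_seq_e_part s ppm am).
by have -> : all (fun ab : 'I_(2 * k) * 'I_(2 * k) => (ab.2 < 2 * k)%N) s by apply/allP.
Qed.

End FromPartitions.

(** * Null sequences and perturbed contractions *)

Section NullSequences.

Variable R : realType.
Implicit Types u v : nat -> R.

Definition null_seq u : Prop := u @ \oo --> (0 : R).

Lemma null_seqD u v : null_seq u -> null_seq v -> null_seq (fun n => u n + v n).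
Proof. by move=> hu hv; rewrite /null_seq -[X in _ --> X](addr0 0); exact: cvgD. Qed.

Lemma null_seqZ (a : R) u : null_seq u -> null_seq (fun n => a * u n).
Proof. by move=> hu; rewrite /null_seq -(mulr0 a); apply: cvgM => //; exact: cvg_cst. Qed.

Lemma null_seq_sum (I : Type) (r : seq I) (P : pred I) (F : I -> nat -> R) :
  (forall i, P i -> null_seq (F i)) -> null_seq (fun n => \sum_(i <- r | P i) F i n).
Proof.
move=> hF; elim: r => [|i r IH].
  rewrite (_ : (fun _ => _) = fun=> 0); first exact: cvg_cst.
  by apply/funext => n; rewrite big_nil.
case Pi: (P i).
  rewrite (_ : (fun _ => _) = fun n => F i n + \sum_(j <- r | P j) F j n).
    by apply: null_seqD => //; exact: hF.
  by apply/funext => n; rewrite big_cons Pi.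
rewrite (_ : (fun _ => _) = fun n => \sum_(j <- r | P j) F j n) //.
by apply/funext => n; rewrite big_cons Pi.
Qed.

Lemma null_seq_le u v : (forall n, 0 <= u n <= v n) -> null_seq v -> null_seq u.
Proof.
move=> uv hv; apply: (@squeeze_cvgr _ _ _ _ (fun=> 0) v u) => //; last exact: cvg_cst.
by near=> n; exact: uv.
Unshelve. all: by end_near.
Qed.

Lemma null_seqP u :
  null_seq u <-> forall eps, 0 < eps -> exists n0, forall n, (n0 <= n)%N -> `|u n| <= eps.
Proof.
split=> [/cvgrPdist_le h eps e0|h].
  have [n0 _ hn] := h eps e0; exists n0 => n nn.
  by have := hn n nn; rewrite /= sub0r normrN.
apply/cvgrPdist_le => eps e0; have [n0 hn] := h eps e0.
by exists n0 => // n nn; rewrite /= sub0r normrN; exact: hn.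
Qed.

Lemma null_seq_contraction (q : R) u v : 0 <= q < 1 -> (forall n, 0 <= u n) ->
  (forall n, u n.+1 <= q * u n + v n) -> null_seq v -> null_seq u.
Proof.
move=> /andP[q0 q1] u0 rec /null_seqP hv; apply/null_seqP => eps e0.
(* With this bound on [v], the value [eps / 2] is the fixed point of the affine recursion, so the
   excess of [u] over it shrinks by the factor [q] at each step. *)
have d0 : 0 < eps / 2 * (1 - q) by rewrite mulr_gt0 ?divr_gt0 ?subr_gt0.
have [n0 hn0] := hv _ d0.
have step i : u (n0 + i)%N - eps / 2 <= q ^+ i * `|u n0 - eps / 2|.
  elim: i => [|i IH]; first by rewrite addn0 expr0 mul1r ler_norm.
  rewrite addnS exprS -mulrA.
  apply: le_trans (ler_wpM2l q0 IH).
  have := rec (n0 + i)%N; have := hn0 (n0 + i)%N (leq_addr _ _).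
  have := ler_norm (v (n0 + i)%N); lra.
have : null_seq (fun i => `|u n0 - eps / 2| * q ^+ i).
  by apply: null_seqZ; apply: cvg_expr; rewrite ger0_norm.
move=> /null_seqP/(_ _ (divr_gt0 e0 (ltr0n R 2))) [i0 hi0].
exists (n0 + i0)%N => n nn; rewrite ger0_norm ?u0 //.
have -> : n = (n0 + (n - n0))%N by lia.
have := step (n - n0)%N.
have := hi0 (n - n0)%N ltac:(lia).
have := ler_norm (`|u n0 - eps / 2| * q ^+ (n - n0)).
rewrite [q ^+ _ * _]mulrC; lra.
Qed.

End NullSequences.

(** * Convergence of the large N expansion *)

Section Expansion.

Variables (R : realType) (k M N : nat) (mu : probability (MxSpace R N) R) (t : R).
Hypothesis haar : haar_A M mu.
Hypotheses (M0 : (0 < M)%N) (MN : (M < N)%N) (kN : (2 * k < N)%N).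
Hypothesis tE : t = 1 - N%:R / M%:R.
Implicit Types c : 'I_(2 * k) -> 'I_N.

Local Notation x := (- (N%:R : R)^-1).

(** The expected sum of the series. It is 0 when [c] is not closed from [j], because transpositions
    below [2 * j] cannot repair the later pairs. *)
Definition series_value j c : R :=
  if closed_from j c then (1 - t) ^+ j * cmom mu j c else 0.

Definition partial_sum j n c : R := \sum_(0 <= r < n) mono_sum t j r c * x ^+ r.

(** This is [cmom_recursion] divided by [N] and multiplied by [(1 - t) ^+ j.+1]; as [1 - t] is
    [N / M], the coefficient [M / N] becomes 1 and [1 / N] becomes [- x * (1 - t)] before rescaling
    the sum of degree [j]. *)
Lemma series_value_recursion (j : 'I_k) c : pairing c ->
  series_value j.+1 c = series_value j c +
  x * \sum_(a : 'I_(2 * k) | (a < 2 * j)%N)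
        (series_value j.+1 (c \o tperm a (ofst j)) +
         (t - 1) * series_value j (c \o tperm a (ofst j))).
Proof.
move=> pc.
have fj : (ofst j < 2 * j.+1)%N by rewrite /=; lia.
have clt (a : 'I_(2 * k)) : (a < 2 * j)%N ->
    closed_from j.+1 (c \o tperm a (ofst j)) = closed_from j.+1 c.
  by move=> aj; apply: closed_from_tperm => //; lia.
have Nn0 : (N%:R : R) != 0 by rewrite pnatr_eq0; lia.
have Mn0 : (M%:R : R) != 0 by rewrite pnatr_eq0; lia.
have [cl|ncl] := boolP (closed_from j.+1 c); last first.
  rewrite /series_value closed_fromS (negbTE ncl) andbF big1 ?mulr0 ?addr0 // => a aj.
  by rewrite closed_fromS clt // (negbTE ncl) andbF mulr0 addr0.
have := cmom_recursion haar cl pc; set cm' := fun c => _; rewrite /= => rec.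
have svE c' : closed_from j.+1 c' -> series_value j c' = (1 - t) ^+ j * cm' c'.
  move=> cl'; rewrite /series_value closed_fromS cl' andbT /cm'.
  by case: ifP; rewrite ?mulr0.
rewrite svE // {1}/series_value cl.
under eq_bigr => a aj do rewrite svE ?clt // /series_value clt // cl mulrCA -/(cm' _).
rewrite big_split /= -!mulr_sumr.
set S := \sum_(a | _) cmom _ _ _ in rec *; set S' := \sum_(a | _) cm' _ in rec *.
have -> : cmom mu j.+1 c = (M%:R * cm' c + S' - S) / N%:R.
  by rewrite -rec addrK mulrAC divff // mul1r.
rewrite exprS tE; set P := (_ ^+ j).
by field; rewrite Nn0 Mn0.
Qed.

(** The terms with [r = 0] agree because [mono_sum0] does not depend on [j]; in the others one
    transposition is removed, so [n.+1] terms on the left match [n] terms in the sum over [a]. *)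
Lemma partial_sum_recursion (j : 'I_k) n c :
  partial_sum j.+1 n.+1 c = partial_sum j n.+1 c +
  x * \sum_(a : 'I_(2 * k) | (a < 2 * j)%N)
        (partial_sum j.+1 n (c \o tperm a (ofst j)) +
         (t - 1) * partial_sum j n (c \o tperm a (ofst j))).
Proof.
rewrite /partial_sum !big_nat_recl // !mono_sum0 -addrA; congr (_ + _).
under eq_bigr do rewrite mono_sum_recursion mulrDl.
rewrite big_split /=; congr (_ + _).
under [in RHS]eq_bigr do rewrite mulr_sumr -big_split.
rewrite mulr_sumr.
under [in RHS]eq_bigr do rewrite mulr_sumr.
rewrite exchange_big /=; apply: eq_bigr => r _.
rewrite mulr_suml; apply: eq_bigr => a _; rewrite exprS /=; ring.
Qed.

(** Subtracting the two recursions bounds the error of level [j.+1] by errors of the same level at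
    transposed colourings, plus errors of level [j] that vanish by induction. Summed over all
    pairings, the former are contracted, since transpositions permute the pairings. *)
Lemma partial_sum_cvg j c : (j <= k)%N -> pairing c ->
  null_seq (fun n => partial_sum j n c - series_value j c).
Proof.
elim: j c => [|j IH] c jk pc.
  (* At level 0 only the term [r = 0] is nonzero, so the partial sums are exact from one term on. *)
  apply/null_seqP => eps e0; exists 1%N => -[//|n] _.
  rewrite /partial_sum big_nat_recl // big1 => [|r _]; last by rewrite mono_sum_below0 mul0r.
  rewrite mono_sum0 /series_value expr0 mul1r.
  have -> : cmom mu 0 c = 1.
    rewrite -[RHS](expect_cst mu); congr expect.
    by apply/funext => A; rewrite /entry_prod big_pred0.
  by case: (closed_from 0 c); rewrite ?mulr1 ?mul0r ?addr0 subrr normr0 ltW.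
pose J := Ordinal jk.
(* Finite functions make it possible to sum the errors over all pairings at once. *)
pose F := {ffun 'I_(2 * k) -> 'I_N}.
pose D n (f : F) : R := `|partial_sum j.+1 n f - series_value j.+1 f|.
pose P (f : F) : bool := `[< pairing f >].
pose tf a (f : F) : F := [ffun s => f (tperm a (ofst J) s)].
have tfE a f : tf a f = f \o tperm a (ofst J) :> (_ -> _).
  by apply/funext => s; rewrite ffunE.
have tfK a : involutive (tf a).
  by move=> f; apply/ffunP => s; rewrite !ffunE tpermK.
have Ptf a f : P (tf a f) = P f.
  have h g : P g -> P (tf a g).
    by move=> /asboolP pg; apply/asboolP; rewrite tfE; exact: pairing_perm.
  by apply/idP/idP => [/h|/h //]; rewrite tfK.
pose err n (f : F) : R := `|partial_sum j n f - series_value j f|.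
pose U n := \sum_(f : F | P f) D n f.
pose V n := \sum_(f : F | P f)
  (err n.+1 f + `|x| * `|t - 1| * \sum_(a : 'I_(2 * k)) err n (tf a f)).
have errn f : P f -> null_seq (err ^~ f).
  by move=> /asboolP pf; apply/norm_cvg0P; apply: IH => //; exact: ltnW.
have Vn : null_seq V.
  apply: null_seq_sum => f Pf; apply: null_seqD.
    by have := errn f Pf; rewrite /null_seq -cvg_shiftS.
  by apply: null_seqZ; apply: null_seq_sum => a _; apply: errn; rewrite Ptf.
have stepD n f : P f -> D n.+1 f <= `|x| * \sum_(a : 'I_(2 * k)) D n (tf a f) +
   (err n.+1 f + `|x| * `|t - 1| * \sum_(a : 'I_(2 * k)) err n (tf a f)).
  move=> /asboolP pf.
  rewrite /D (partial_sum_recursion J) (series_value_recursion J pf) /=.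
  have -> (a b r s1 s2 : R) : a + r * s1 - (b + r * s2) = r * (s1 - s2) + (a - b) by ring.
  apply: le_trans (ler_normD _ _) _.
  rewrite addrA [X in _ <= X]addrAC lerD2r normrM -mulrA -mulrDr ler_wpM2l //.
  rewrite -sumrB mulr_sumr -big_split /=.
  apply: le_trans (ler_norm_sum _ _ _) _.
  (* The sum is enlarged to all [a], giving a contraction factor that does not depend on [j]. *)
  rewrite [X in X <= _]big_mkcond /=; apply: ler_sum => a _.
  case: ifP => _; last by rewrite /D /err addr_ge0 ?mulr_ge0.
  rewrite /err !tfE -normrM.
  have -> (a1 a2 b1 b2 r : R) : a1 + r * a2 - (b1 + r * b2) = (a1 - b1) + r * (a2 - b2) by ring.
  exact: ler_normD.
have Un : null_seq U.
  (* The factor is [2 * k / N], less than 1 by [kN]. *)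
  apply: (@null_seq_contraction _ (`|x| * (2 * k)%:R) U V) => //.
  - rewrite mulr_ge0 //= normrN ger0_norm ?invr_ge0 // mulrC.
    by rewrite ltr_pdivrMr ?ltr0n ?mul1r ?ltr_nat //; lia.
  - by move=> n; apply: sumr_ge0 => f _; exact: normr_ge0.
  move=> n; apply: le_trans (ler_sum _ (fun f Pf => stepD n f Pf)) _.
  rewrite big_split /= lerD2r -mulr_sumr -mulrA ler_wpM2l //.
  rewrite exchange_big /= (eq_bigr (fun=> U n)) => [|a _].
    by rewrite sumr_const card_ord mulr_natl.
  rewrite /U [RHS](reindex_inj (inv_inj (tfK a))) /=.
  by apply: eq_bigl => f; rewrite Ptf.
pose f0 : F := [ffun s => c s].
have f0E : f0 = c :> (_ -> _) by apply/funext => s; rewrite ffunE.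
apply/norm_cvg0P; apply: null_seq_le Un => n; rewrite normr_ge0 /=.
rewrite /U (bigD1 f0) /=; last by apply/asboolP; rewrite f0E.
by rewrite /D f0E lerDl sumr_ge0 // => f _; exact: normr_ge0.
Qed.

End Expansion.

Theorem mainTheorem4 (R : realType) (k : nat) (m : {set {set 'I_(2*k)}})
  (hm : pair_partition m) (t : R) :
  exists N0 : nat, forall (M N : nat), (0 < M)%N -> (M < N)%N -> (N0 <= N)%N ->
    t = 1 - N%:R / M%:R ->
    forall (i : 'I_(2*k) -> 'I_N), adapted m i ->
    forall mu : probability (MxSpace R N) R, haar_A M mu ->
      mu.-integrable setT (fun A : MxSpace R N => (wg_integrand i A)%:E) /\
      ((fun n : nat => (1 - t) ^- k *
         \sum_(0 <= r < n) heval r m t * (- (N%:R)^-1) ^+ r) : nat -> R)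
        @ \oo --> (Rintegral mu setT (fun A : MxSpace R N => wg_integrand i A) : R).
Proof.
(* The threshold ensures [2 * k < N], as the contraction requires. *)
exists (2 * k).+1 => M N M0 MN kN tE i ai mu haar.
have EW : wg_integrand i = entry_prod k i :> (MxSpace R N -> R).
  by apply/funext => A; apply: eq_bigl => l; rewrite ltn_ord.
split.
  have := bounded_obs_integrable haar (bounded_obs_entry_prod R M k i).
  by rewrite -EW.
have pc := pairing_adapted hm ai.
have cl : closed_from k i by apply/closed_fromP => l; rewrite leqNgt ltn_ord.
have := partial_sum_cvg haar M0 MN kN tE (leqnn k) pc.
rewrite /null_seq => /subr_cvg0; rewrite /series_value cl => cv.
have t0 : (1 - t) ^+ k != 0.
  by rewrite expf_neq0 // tE opprB addrC subrK mulf_neq0 ?invr_eq0 ?pnatr_eq0; lia.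
(* The series converges to the moment scaled by [(1 - t) ^+ k], which the prefactor undoes. *)
have -> : Rintegral mu setT (fun A : MxSpace R N => wg_integrand i A) =
    (1 - t) ^- k * ((1 - t) ^+ k * cmom mu k i) by rewrite mulKf // /cmom -EW.
apply: cvgM; first exact: cvg_cst.
under eq_fun => n do under eq_bigr => r _ do rewrite (heval_mono_sum t r hm ai).
exact: cv.
Qed.
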